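(* Let $M$ be a positive integral finitely generated commutative binoid. The following conditions are equivalent: (1) $M$ is separated. (2) $M$ is positively $\mathbb N^k$-graded for some $k\ge1$. (3) $M$ is positively $\mathbb N$-graded.
   Context: A commutative binoid (written additively) is a commutative monoid $(M,+,0)$ with an absorbing element $\infty$ ($a+\infty=\infty$). $M^\times$ is the group of units and $M_+=M\setminus M^\times$. $M$ is positive if $M^\times=\{0\}$; integral if $0\neq\infty$ and $M\setminus\{\infty\}$ is a submonoid, i.e. $a+b=\infty$ implies $a=\infty$ or $b=\infty$; finitely generated if there are finitely many elements such that every element $\neq\infty$ is a finite sum of them. With $nM_+=\{a_1+\cdots+a_n\mid a_i\in M_+\}$, a nonzero binoid $M$ is separated if $\bigcap_{n\ge1}nM_+=\{\infty\}$. For a monoid $D$, $M$ is $D$-graded if there is a map $\delta:M\setminus\{\infty\}\to D$ with $\delta(0)=0$ and $\delta(x+y)=\delta(x)+\delta(y)$ whenever $x,y\in M\setminus\{\infty\}$ and $x+y\neq\infty$. The grading is positive ($M$ is positively $D$-graded) if in addition nonunits $\neq\infty$ are mapped to nonunits, i.e. $\delta(M_+\setminus\{\infty\})\subseteq D\setminus D^\times$. *)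

(* Defs.v *)
From HB Require Import structures.
From mathcomp Require Import all_boot all_order all_algebra.
From mathcomp Require Import boolp classical_sets.

Set Implicit Arguments.
Unset Strict Implicit.
Unset Printing Implicit Defensive.

Import GRing.Theory.
Local Open Scope classical_set_scope.
Local Open Scope ring_scope.

HB.mixin Record Nmodule_isBinoid M of GRing.Nmodule M := {
  infty : M;
  addr_infty : forall a : M, a + infty = infty
}.

#[short(type="commBinoidType")]
HB.structure Definition CommBinoid :=
  {M of GRing.Nmodule M & Nmodule_isBinoid M}.

Definition monoid_units (D : nmodType) : set D :=
  [set a | exists b, a + b = 0].

Arguments monoid_units : clear implicits.

Definition nonunits (D : nmodType) : set D := ~` monoid_units D.

Arguments nonunits : clear implicits.

Definition binoid_positive (M : commBinoidType) : Prop :=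
  monoid_units M = [set 0].

Definition binoid_integral (M : commBinoidType) : Prop :=
  (0 : M) <> infty /\
  forall a b : M, a + b = infty -> a = infty \/ b = infty.

Definition finitely_generated (M : commBinoidType) : Prop :=
  exists s : seq M, forall x : M, x <> infty ->
    exists t : seq M, {subset t <= s} /\ x = \sum_(y <- t) y.

(* The n-fold sumset nM_+; only meant for n >= 1. *)
Definition nonunits_sumset (M : commBinoidType) (n : nat) : set M :=
  [set x | exists a : 'I_n -> M,
     (forall i, nonunits M (a i)) /\ x = \sum_(i < n) a i].

Arguments nonunits_sumset : clear implicits.

Definition separated (M : commBinoidType) : Prop :=
  (0 : M) <> infty /\
  \bigcap_(n in [set n : nat | (1 <= n)%N]) nonunits_sumset M n = [set infty].

(* A map on M \ {infty} is encoded as a map on M whose value at infty is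
   never constrained (when 0 <> infty). *)
Definition is_grading (M : commBinoidType) (D : nmodType) (delta : M -> D)
    : Prop :=
  delta 0 = 0 /\
  forall x y : M, x <> infty -> y <> infty -> x + y <> infty ->
    delta (x + y) = delta x + delta y.

Definition is_positive_grading (M : commBinoidType) (D : nmodType)
    (delta : M -> D) : Prop :=
  is_grading delta /\
  forall x : M, nonunits M x -> x <> infty -> nonunits D (delta x).

Definition positively_graded (M : commBinoidType) (D : nmodType) : Prop :=
  exists delta : M -> D, is_positive_grading delta.

(* Main.v *)
Require Import Defs.
From mathcomp Require Import all_boot all_order all_algebra.
From mathcomp Require Import boolp classical_sets.
From mathcomp Require Import ring lra.

Set Implicit Arguments.
Unset Strict Implicit.
Unset Printing Implicit Defensive.

Import Order.TTheory GRing.Theory Num.Theory.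
Local Open Scope ring_scope.

(* The only hard implication is (1) => (3). Let g_1, ..., g_r be nonzero
   generators and consider the group of differences a - b in Z^r of exponent
   vectors with the same value in M. If it contained a nonzero vector with
   nonnegative entries, then x + e = x for some x <> infty and e <> 0, so x
   would lie in every nM_+. Otherwise Stiemke's lemma gives a strictly positive
   integral weight vector orthogonal to all these differences, and the weighted
   degree of exponent vectors descends to a positive N-grading of M. *)

(** * Theorems of the alternative over ordered fields *)

Lemma exists_between_seq (F : realFieldType) (x : F) (ys : seq F) :
  {in ys, forall y, x < y} -> exists2 t, x < t & {in ys, forall y, t < y}.
Proof.
elim: ys => [|y ys IH] xlt; first by exists (x + 1); rewrite ?ltrDl ?ltr01.
have [|t xt tlt] := IH; first by move=> z zin; apply: xlt; rewrite inE zin orbT.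
have xy : x < y by apply: xlt; rewrite mem_head.
exists (Num.min t ((x + y) / 2)); first by rewrite lt_min xt midf_lt.
move=> z; rewrite inE gt_min => /predU1P[->|/tlt -> //].
by rewrite (midf_lt xy) orbT.
Qed.

(** Solvability criterion for one unknown with strict lower bounds [xs] and strict upper bounds
    [ys]; either list may be empty. This provides the eliminated coordinate in Fourier-Motzkin
    elimination. *)
Lemma exists_separating_value (F : realFieldType) (xs ys : seq F) :
  {in xs & ys, forall x y, x < y} ->
  exists t, {in xs, forall x, x < t} /\ {in ys, forall y, t < y}.
Proof.
elim: xs => [|x xs IH] lt_xy.
  elim: ys {lt_xy} => [|y ys [t [_ tlt]]]; first by exists 0.
  exists (Num.min t (y - 1)); split=> // z; rewrite inE gt_min.
  by case/predU1P=> [->|/tlt -> //]; rewrite ltrBlDr ltrDl ltr01 orbT.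
have [|t [ltt tlt]] := IH.
  by move=> a b ain; apply: lt_xy; rewrite inE ain orbT.
have [lt_xt|le_tx] := ltP x t.
  by exists t; split=> // z; rewrite inE => /predU1P[->|/ltt].
have [y|t' xt' t'lt] := @exists_between_seq _ x ys.
  by apply: lt_xy; rewrite mem_head.
exists t'; split=> // z; rewrite inE => /predU1P[-> //|/ltt zt].
exact: lt_trans zt (le_lt_trans le_tx xt').
Qed.

(* Gordan's alternative, by Fourier-Motzkin elimination of the first
   coordinate: each pair of vectors whose first coordinates have opposite signs
   is replaced by its positive combination with first coordinate 0. *)
Lemma positive_functional_or_cone0 (F : realFieldType) (m : nat)
    (s : seq 'rV[F]_m) (P : 'rV[F]_m -> Prop) :
    (forall u v, P u -> P v -> P (u + v)) ->
    (forall c v, 0 < c -> P v -> P (c *: v)) ->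
    {in s, forall v, P v} ->
  (exists y : 'cV[F]_m, {in s, forall v, 0 < (v *m y) 0 0}) \/ P 0.
Proof.
elim: m s P => [|m IH] s P PD PZ Ps.
  case: s Ps => [|v s] Ps; first by left; exists 0.
  by right; rewrite -(thinmx0 v); apply: Ps; rewrite mem_head.
have dotE (v : 'rV[F]_(1 + m)) (t : F) (y : 'cV[F]_m) :
    (v *m (col_mx t%:M y : 'cV_(1 + m))) 0 0 = v 0 0 * t + (rsubmx v *m y) 0 0.
  rewrite -{1}(hsubmxK v) mul_row_col mul_mx_scalar !mxE mulrC.
  by congr (v _ _ * _ + _); apply/val_inj.
pose comb (u v : 'rV[F]_m.+1) : 'rV[F]_(1 + m) := - v 0 0 *: u + u 0 0 *: v.
pose s0 := [seq rsubmx (v : 'rV[F]_(1 + m)) |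
             v <- [seq v : 'rV[F]_m.+1 <- s | v 0 0 == 0]].
pose pos := [seq v : 'rV[F]_m.+1 <- s | 0 < v 0 0].
pose neg := [seq v : 'rV[F]_m.+1 <- s | v 0 0 < 0].
pose s1 := [seq rsubmx (comb u v) | u <- pos, v <- neg].
have tailP (v : 'rV[F]_(1 + m)) : v 0 0 = 0 -> P v ->
    P (row_mx (0 : 'rV_1) (rsubmx v)).
  move=> v0 Pv; suff -> : row_mx (0 : 'rV_1) (rsubmx v) = v by [].
  rewrite -[RHS](hsubmxK v); congr row_mx; apply/rowP => i.
  by rewrite !mxE -v0; congr (v _ _); apply/val_inj; rewrite /= (ord1 i).
(* Vectors with first coordinate 0 are identified with their tails, so the induction hypothesis is
   applied to the cone of those tails [w] for which (0, w) satisfies [P]. *)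
have [||v|[y' y'P]|P0] := IH (s0 ++ s1) (fun w => P (row_mx (0 : 'rV_1) w)).
- by move=> u v Pu Pv; rewrite -[0]addr0 -add_row_mx; apply: PD.
- by move=> c v c0 Pv; rewrite -(scaler0 _ c) -scale_row_mx; apply: PZ.
- rewrite mem_cat => /orP[/mapP[w]|/allpairsP[[u w] /= []]].
    by rewrite mem_filter => /andP[/eqP w0 ws] ->; apply/tailP/Ps.
  rewrite !mem_filter => /andP[u0 us] /andP[w0 ws] ->; apply: tailP.
    by rewrite /comb !mxE; ring.
  by apply: PD; apply: PZ; rewrite ?oppr_gt0 //; apply: Ps.
- left; pose d (v : 'rV[F]_(1 + m)) := (rsubmx v *m y') 0 0.
  (* [bound v] is the value of the first coordinate [t] at which the functional extending [y']
     vanishes on [v]. So [t] must exceed it for [v] in [pos] and stay below it for [v] in [neg];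
     positivity of [y'] on the tail of [comb u v] says exactly that [bound u < bound v]. *)
  pose bound (v : 'rV[F]_(1 + m)) := - d v / v 0 0.
  have [_ _ /mapP[u uin ->] /mapP[v vin ->]|t [post negt]] :=
      @exists_separating_value _ [seq bound v | v <- pos]
                                 [seq bound v | v <- neg].
    have := y'P (rsubmx (comb u v)); rewrite mem_cat.
    have -> /= : rsubmx (comb u v) \in s1 by apply/allpairsP; exists (u, v).
    rewrite orbT -/(d _) => /(_ isT).
    have -> : d (comb u v) = - v 0 0 * d u + u 0 0 * d v.
      rewrite /d /comb linearD !linearZ /= mulmxDl -!scalemxAl mxE.
      by congr (_ + _); rewrite mxE.
    move: uin vin; rewrite !mem_filter => /andP[u0 _] /andP[v0 _] dlt.
    rewrite /bound ltr_pdivrMr // mulrAC ltr_ndivlMr //;  lra.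
  exists (col_mx t%:M y' : 'cV_(1 + m)) => v vs; rewrite dotE -/(d v).
  have [v0|v0|v0] := ltgtP (v 0 0) 0.
  + have := negt (bound v) (map_f _ _); rewrite mem_filter v0 vs => /(_ isT).
    by rewrite /bound ltr_ndivlMr //; lra.
  + have := post (bound v) (map_f _ _); rewrite mem_filter v0 vs => /(_ isT).
    by rewrite /bound ltr_pdivrMr //; lra.
  + rewrite v0 mul0r add0r; apply: y'P; rewrite mem_cat map_f //.
    by rewrite mem_filter v0 eqxx.
- by right; move: P0; rewrite row_mx0.
Qed.

(** If no matrix had row space [L], any matrix with rows in [L] could be enlarged by a vector of [L]
    outside its row space, and the rank would eventually exceed [n]. *)
Lemma subspace_matrix (F : fieldType) (n : nat) (L : 'rV[F]_n -> Prop) :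
    L 0 -> (forall u v, L u -> L v -> L (u + v)) ->
    (forall c v, L v -> L (c *: v)) ->
  exists B : 'M[F]_n, forall v : 'rV_n, L v <-> (v <= B)%MS.
Proof.
move=> L0 LD LZ.
pose sub (B : 'M[F]_n) := forall v : 'rV_n, (v <= B)%MS -> L v.
have [//|noB] := pselect (exists B : 'M[F]_n, forall v, L v <-> (v <= B)%MS).
have [] : exists2 B, sub B & (n.+1 <= \rank B)%N; last first.
  by move=> B _; rewrite ltnNge rank_leq_row.
elim: n.+1 => [|k [B subB rkB]].
  by exists 0 => // v; rewrite submx0 => /eqP ->.
have [v Lv vB] : exists2 v, L v & ~~ (v <= B)%MS.
  apply: contrapT => nov; apply: noB; exists B => v; split; last exact: subB.
  by move=> Lv; apply: contrapT => /negP vB; apply: nov; exists v.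
exists (B + v)%MS.
  move=> u /sub_addsmxP[[a b] /= ->]; apply: LD; first exact/subB/submxMl.
  by rewrite (mx11_scalar b) mul_scalar_mx; apply: LZ.
apply: leq_ltn_trans rkB _.
rewrite (ltn_leqif (mxrank_leqif_sup _)) ?addsmxSl //.
by rewrite addsmx_sub submx_refl.
Qed.

(* Stiemke's lemma. *)
Lemma positive_orthogonal_vector (F : realFieldType) (n : nat)
    (L : 'rV[F]_n -> Prop) :
    L 0 -> (forall u v, L u -> L v -> L (u + v)) ->
    (forall c v, L v -> L (c *: v)) ->
    (forall v, L v -> (forall i, 0 <= v 0 i) -> v = 0) ->
  exists w : 'cV[F]_n,
    (forall i, 0 < w i 0) /\ forall v, L v -> v *m w = 0.
Proof.
move=> L0 LD LZ Lge0; have [B BP] := subspace_matrix L0 LD LZ.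
(* [P] is the image, modulo [L], of the nonzero nonnegative vectors; the rows of [cokermx B] are the
   images of the unit vectors. If 0 satisfies [P], then [L] contains a nonzero nonnegative vector.
   Otherwise a functional [y] positive on these rows makes [cokermx B *m y] strictly positive and
   orthogonal to [L]. *)
pose P (v : 'rV[F]_n) := exists u : 'rV[F]_n,
  [/\ forall i, 0 <= u 0 i, u != 0 & v = u *m cokermx B].
have [||v|[y yP]|[u [u0 unz uB]]] :=
    @positive_functional_or_cone0 _ _
      [seq row i (cokermx B) | i <- enum 'I_n] P.
- move=> _ _ [u [u0 unz ->]] [v [v0 _ ->]]; exists (u + v).
  split; last by rewrite mulmxDl.
    by move=> i; rewrite mxE addr_ge0.
  apply: contra unz => /eqP uv0; apply/eqP/rowP => i.
  have /rowP/(_ i)/eqP := uv0; rewrite !mxE paddr_eq0 // => /andP[/eqP].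
  by [].
- move=> c _ c0 [u [u0 unz ->]]; exists (c *: u); split.
  + by move=> i; rewrite mxE mulr_ge0 // ltW.
  + by rewrite scaler_eq0 negb_or unz gt_eqF.
  + by rewrite scalemxAl.
- case/mapP=> i _ ->; exists (delta_mx 0 i); split; last by rewrite rowE.
    by move=> j; rewrite mxE; case: (_ && _).
  apply/eqP => /rowP/(_ i)/eqP; rewrite !mxE !eqxx /=.
  by rewrite oner_eq0.
- exists (cokermx B *m y); split=> [i|v /BP vB].
    have : i \in enum 'I_n by rewrite mem_enum.
    by move=> /(map_f (fun j => row j (cokermx B)))/yP; rewrite -row_mul mxE.
  have vK : v *m cokermx B = 0 by apply/eqP; rewrite -submxE.
  by rewrite mulmxA vK mul0mx.
- case/eqP: unz; apply: Lge0 => //; apply/BP; rewrite submxE -uB; exact: eqxx.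
Qed.

(** * Integral weights compatible with the relations *)

Lemma common_denominator (n : nat) (w : 'I_n -> rat) :
    (forall i, 0 < w i) ->
  exists N : nat, exists W : 'I_n -> nat,
    (0 < N)%N /\ forall i, (0 < W i)%N /\ (W i)%:R = N%:R * w i.
Proof.
move=> w_gt0; exists (\prod_i `|denq (w i)|)%N.
exists (fun i => `|numq (w i)| * \prod_(j | j != i) `|denq (w j)|)%N.
have den_gt0 i : (0 < `|denq (w i)|)%N by rewrite absz_gt0 denq_neq0.
split=> [|i]; first exact: prodn_gt0.
split; first by rewrite muln_gt0 prodn_gt0 // absz_gt0 numq_eq0 gt_eqF ?w_gt0.
rewrite [in RHS](bigD1 i) //= !natrM mulrAC; congr (_ * _).
rewrite !pmulrn !abszE !ger0_norm ?denq_ge0 ?numq_ge0 ?(ltW (w_gt0 i)) //.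
by rewrite mulrC numqE.
Qed.

(** Stiemke's lemma over the rationals gives positive weights orthogonal to all relations, and
    clearing denominators makes them integral. The hypothesis on [b] and [c] rules out a nonzero
    nonnegative vector in the span of the relations. *)
Lemma positive_weights (M : nmodType) (r : nat) (x : 'I_r -> M) :
    (forall b c : 'I_r -> nat,
       \sum_i x i *+ b i + \sum_i x i *+ c i = \sum_i x i *+ b i ->
       forall i, c i = 0%N) ->
  exists W : 'I_r -> nat, (forall i, (0 < W i)%N) /\
    forall a b : 'I_r -> nat, \sum_i x i *+ a i = \sum_i x i *+ b i ->
      (\sum_i W i * a i = \sum_i W i * b i)%N.
Proof.
move=> noabs.
(* L is the Q-span of the differences a - b of relations a ~ b; these
   differences form a group, so clearing denominators suffices. *)
pose L (v : 'rV[rat]_r) := exists n : nat, exists a b : 'I_r -> nat,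
  [/\ (0 < n)%N, forall i, n%:R * v 0 i = (a i)%:R - (b i)%:R
    & \sum_i x i *+ a i = \sum_i x i *+ b i].
have [|u v|c v|v|w [w_gt0 wL]] := @positive_orthogonal_vector _ _ L.
- exists 1%N, (fun=> 0%N), (fun=> 0%N); split=> // i.
  by rewrite mxE mulr0 subrr.
- move=> [n [a [b [n0 nu ab]]]] [p [c [d [p0 pv cd]]]].
  exists (n * p)%N, (fun i => a i * p + c i * n)%N,
    (fun i => b i * p + d i * n)%N.
  split=> [|i|]; first by rewrite muln_gt0 n0.
    rewrite mxE !natrD !natrM.
    have -> : n%:R * p%:R * (u 0 i + v 0 i) =
        p%:R * (n%:R * u 0 i) + n%:R * (p%:R * v 0 i) :> rat by ring.
    by rewrite nu pv; ring.
  under eq_bigr do rewrite mulrnDr !mulrnA.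
  under [RHS]eq_bigr do rewrite mulrnDr !mulrnA.
  by rewrite !big_split /= !sumrMnl ab cd.
- move=> [n [a [b [n0 nv ab]]]].
  have LZ (k : nat) (e f : 'I_r -> nat) :
      \sum_i x i *+ e i = \sum_i x i *+ f i ->
      \sum_i x i *+ (e i * k) = \sum_i x i *+ (f i * k).
    move=> ef; under eq_bigr do rewrite mulrnA.
    by under [RHS]eq_bigr do rewrite mulrnA; rewrite !sumrMnl ef.
  have den (y : rat) : (`|denq c|%N * n)%:R * (c * y) =
      (numq c)%:~R * (n%:R * y).
    rewrite natrM numqE natr_absz ger0_norm ?denq_ge0 //; ring.
  have den0 : (0 < `|denq c|%N * n)%N by rewrite muln_gt0 absz_gt0 denq_neq0.
  (* After multiplication by the denominator of [c], only its numerator remains; a negative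
     numerator exchanges the two sides of the relation. *)
  case: (intP (numq c)) den => [|k|k] den.
  + exists (`|denq c|%N * n)%N, (fun=> 0%N), (fun=> 0%N); split=> // i.
    by rewrite mxE den mul0r subrr.
  + exists (`|denq c|%N * n)%N, (fun i => a i * k.+1)%N,
      (fun i => b i * k.+1)%N.
    split=> // [i|]; last exact: LZ.
    by rewrite mxE den nv !natrM; ring.
  + exists (`|denq c|%N * n)%N, (fun i => b i * k.+1)%N,
      (fun i => a i * k.+1)%N.
    split=> // [i|]; last by apply: LZ.
    by rewrite mxE den nv !natrM rmorphN /=; ring.
- move=> [n [a [b [n0 nv ab]]]] v0.
  (* Nonnegativity of [v] means [b <= a] entrywise, so the relation reads as [b] absorbing [a - b],
     and [noabs] forces [a - b] to vanish. *)
  have le_ba i : (b i <= a i)%N.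
    by rewrite -(ler_nat rat) -subr_ge0 -nv mulr_ge0.
  have c0 := noabs b (fun i => a i - b i)%N.
  apply/rowP => i; rewrite mxE; apply/eqP.
  have /eqP := nv i; rewrite -natrB // c0.
    by rewrite mulf_eq0 pnatr_eq0 eqn0Ngt n0.
  rewrite -big_split /= -[RHS]ab; apply: eq_bigr => j _.
  by rewrite -mulrnDr subnKC.
have [N [W [N0 WP]]] := common_denominator w_gt0.
exists W; split=> [i|a b ab]; first by have [] := WP i.
have /wL/matrixP/(_ 0 0) : L (\row_i ((a i)%:R - (b i)%:R)).
  by exists 1%N, a, b; split=> // i; rewrite mxE mul1r.
rewrite !mxE => /(congr1 ( *%R N%:R)); rewrite mulr0 mulr_sumr => sum0.
apply/eqP; rewrite -(eqr_nat rat) -subr_eq0 !natr_sum.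
rewrite -sumrB; apply/eqP; rewrite -[RHS]sum0; apply: eq_bigr => i _.
by rewrite !mxE !natrM; have [_ ->] := WP i; ring.
Qed.

(** * Elementary facts on binoids *)

Lemma infty_addr (M : commBinoidType) (y : M) :
  infty + y = infty.
Proof. by rewrite addrC addr_infty. Qed.

Lemma infty_nonunit (M : commBinoidType) :
  (0 : M) <> infty -> nonunits M infty.
Proof. by move=> nz [b]; rewrite infty_addr => /esym. Qed.

Lemma unit_nat (n : nat) : monoid_units nat n -> n = 0%N.
Proof. by case=> b /eqP; rewrite addn_eq0 => /andP[/eqP]. Qed.

Lemma integral_sum_neq_infty (M : commBinoidType) (I : Type) (s : seq I)
    (P : pred I) (f : I -> M) :
    binoid_integral M -> (forall i, P i -> f i <> infty) ->
  \sum_(i <- s | P i) f i <> infty.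
Proof.
move=> [nz Mint] fP; apply: (big_ind (fun x => x <> infty)) => //.
  by move=> a b ainf binf /Mint[].
Qed.

Lemma positive_nonunit (M : commBinoidType) (x : M) :
  binoid_positive M -> x <> 0 -> nonunits M x.
Proof. by move=> Mpos xnz; rewrite /nonunits Mpos. Qed.

Lemma positive_addr_eq0 (M : commBinoidType) (x y : M) :
  binoid_positive M -> x + y = 0 -> x = 0.
Proof.
move=> Mpos xy; have : monoid_units M x by exists y.
by rewrite Mpos.
Qed.

(** * Gradings and separatedness *)

(** The total degree works: a sum of natural numbers is 0 only if each of them is. *)
Lemma positively_graded_ffun_nat (M : commBinoidType) (k : nat) :
  positively_graded M {ffun 'I_k -> nat} -> positively_graded M nat.
Proof.
case=> d [[d0 dD] dpos]; exists (fun x => \sum_i d x i); split.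
  split=> [|x y xi yi xyi]; first by rewrite d0 big1 // => i _; rewrite ffunE.
  by rewrite dD // -big_split; apply: eq_bigr => i _; rewrite ffunE.
move=> x xnu xi /unit_nat/eqP; rewrite sum_nat_eq0 => /forallP dx.
apply: (dpos x xnu xi); exists 0; rewrite addr0; apply/ffunP => i.
by rewrite ffunE; apply/eqP/(implyP (dx i)).
Qed.

Lemma positively_graded_nat_ffun1 (M : commBinoidType) :
  positively_graded M nat -> positively_graded M {ffun 'I_1 -> nat}.
Proof.
case=> d [[d0 dD] dpos]; exists (fun x => [ffun=> d x]); split.
  split=> [|x y xi yi xyi]; apply/ffunP => i; rewrite !ffunE //.
  exact: dD.
move=> x xnu xi [b /ffunP/(_ ord0)]; rewrite !ffunE => db.
by apply: (dpos x xnu xi); exists (b ord0).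
Qed.

Lemma grading_sum (M : commBinoidType) (D : nmodType) (d : M -> D) (I : Type)
    (s : seq I) (f : I -> M) :
    is_grading d -> \sum_(i <- s) f i <> infty ->
  d (\sum_(i <- s) f i) = \sum_(i <- s) d (f i).
Proof.
move=> [d0 dD]; elim: s => [|i s IH]; first by rewrite !big_nil.
rewrite !big_cons => sumi; rewrite -IH => [|si]; last first.
  by apply: sumi; rewrite si addr_infty.
apply: dD => // e; apply: sumi; first by rewrite e infty_addr.
by rewrite e addr_infty.
Qed.

(** Nonunits other than [infty] have degree at least 1, so an element [x <> infty] that is a sum of
    [n] nonunits has degree at least [n]; this fails for [n = d x + 1]. *)
Lemma positively_graded_nat_separated (M : commBinoidType) :
  (0 : M) <> infty -> positively_graded M nat -> separated M.
Proof.
move=> nz [d [dgr dpos]]; split=> //; apply/seteqP; split=> x /=.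
  move=> xin; apply: contrapT => xi.
  have [a [anu xE]] := xin (d x).+1 isT.
  have ai i : a i <> infty.
    by move=> ai; apply: xi; rewrite xE (bigD1 i) //= ai infty_addr.
  suff: ((d x).+1 <= d x)%N by rewrite ltnn.
  rewrite {2}xE grading_sum -?xE // -[X in (X <= _)%N]card_ord -sum1_card.
  apply: leq_sum => i _; rewrite lt0n; apply/eqP => dai.
  by apply: (dpos _ (anu i) (ai i)); exists 0; rewrite addr0.
move=> -> [//|n] _; exists (fun=> infty); split=> [i|].
  exact: infty_nonunit.
by rewrite big_ord_recl infty_addr.
Qed.

(* From x = x + e one gets x = x + n e for every n, so x lies in every nM_+. *)
Lemma separated_addr_absorb (M : commBinoidType) (x y : M) :
    binoid_positive M -> separated M -> x <> infty -> x + y = x -> y = 0.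
Proof.
move=> Mpos [_ sep] xi xy; apply: contrapT => ynz; apply: xi.
suff : [set infty]%classic x by [].
rewrite -sep => -[//|n] _.
have xyn k : x + y *+ k = x.
  by elim: k => [|k IH]; rewrite ?addr0 // mulrS addrA xy.
(* The first summand is [x + y] rather than [x], because [x] may be 0; positivity makes [x + y] a
   nonunit. *)
exists (fun i => if i == ord0 then x + y else y); split=> [i|].
  apply: positive_nonunit => //; case: eqP => // _.
  by rewrite addrC => /(positive_addr_eq0 Mpos).
rewrite big_ord_recl eqxx (eq_bigr (fun=> y)) // sumr_const card_ord.
by rewrite -addrA -mulrS xyn.
Qed.

(** * Construction of the grading from generators *)

Lemma nonzero_generators (M : commBinoidType) :
    finitely_generated M ->
  exists r : nat, exists g : 'I_r -> M,
    (forall i, g i <> 0 /\ g i <> infty) /\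
    forall x, x <> infty -> exists a : 'I_r -> nat, x = \sum_i g i *+ a i.
Proof.
move=> [s sgen].
pose s' := [seq y <- s | (y != 0) && (y != infty)].
exists (size s'), (fun i => tnth (in_tuple s') i); split=> [i|x xi].
  have : tnth (in_tuple s') i \in s' by apply: mem_tnth.
  by rewrite mem_filter => /andP[/andP[/eqP ? /eqP ?] _].
have [t [ts xE]] := sgen x xi; rewrite {x}xE in xi *.
elim: t ts xi => [|y t IH] ts; rewrite ?big_nil ?big_cons => sumi.
  by exists (fun=> 0%N); rewrite big1.
have [||a ->] := IH.
- by move=> z zt; apply: ts; rewrite inE zt orbT.
- by move=> ti; apply: sumi; rewrite ti addr_infty.
have [->|ynz] := eqVneq y 0; first by exists a; rewrite add0r.
have /(tnthP (in_tuple s'))[j ->] : y \in s'.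
  rewrite mem_filter ynz ts ?mem_head //= andbT; apply/eqP => yi.
  by apply: sumi; rewrite yi infty_addr.
exists (fun i => (i == j) + a i)%N; under [RHS]eq_bigr do rewrite mulrnDr.
rewrite big_split /=; congr (_ + _).
by rewrite (bigD1 j) //= eqxx big1 ?addr0 // => i /negPf ->.
Qed.

Lemma separated_positively_graded_nat (M : commBinoidType) :
    binoid_positive M -> binoid_integral M -> finitely_generated M ->
  separated M -> positively_graded M nat.
Proof.
move=> Mpos Mint Mfg sep.
have [r [g [gP ggen]]] := nonzero_generators Mfg.
have comb0 (c : 'I_r -> nat) : \sum_i g i *+ c i = 0 -> forall i, c i = 0%N.
  move=> sum0 i; case ci: (c i) => [//|k]; move: sum0.
  rewrite (bigD1 i) //= ci mulrS -addrA => /(positive_addr_eq0 Mpos).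
  by case: (gP i).
(* An absorbed combination is 0 by separatedness, hence has zero coefficients by [comb0]. The
   absorbing sum differs from [infty] by integrality, applied first to the sum and then to each
   multiple [g i *+ b i] written as an iterated sum. *)
have [b c absorb|W [W_gt0 WP]] := @positive_weights _ _ g.
  apply/comb0/(separated_addr_absorb Mpos sep _ absorb).
  apply: integral_sum_neq_infty => // i _; rewrite -[b i]subn0 -sumr_const_nat.
  by apply: integral_sum_neq_infty => // _ _; case: (gP i).
(* An exponent vector is chosen for each element, with a dummy value at [infty]. The choice need not
   be additive: by [WP] the weighted degree does not depend on it. *)
have [coef coefP] : {coef : M -> 'I_r -> nat
  & forall x, x <> infty -> x = \sum_i g i *+ coef x i}.
  apply: (choice (P := fun (x : M) (a : 'I_r -> nat) =>
    x <> infty -> x = \sum_i g i *+ a i)) => x.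
  have [->|/ggen[a xE]] := pselect (x = infty); last by exists a.
  by exists (fun=> 0%N).
exists (fun x => \sum_i W i * coef x i)%N; split.
  split=> [|x y xi yi xyi].
    rewrite big1 // => i _; rewrite (comb0 (coef 0)) ?muln0 // -coefP //.
    by case: Mint.
  transitivity (\sum_i W i * (coef x i + coef y i))%N; last first.
    by rewrite -big_split; apply: eq_bigr => i _; apply: mulnDr.
  apply: WP; rewrite -coefP //; under eq_bigr do rewrite mulrnDr.
  by rewrite big_split /= -!coefP.
(* All weights are positive, so degree 0 forces every coefficient to vanish, whence [x = 0] is a
   unit. *)
move=> x xnu xi /unit_nat/eqP; rewrite sum_nat_eq0 => /forallP W0.
apply: xnu; exists 0; rewrite addr0 (coefP x) // big1 // => i _.
by have := implyP (W0 i) isT; rewrite muln_eq0 gtn_eqF //= => /eqP ->.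
Qed.

Theorem theorem5p2p7 (M : commBinoidType)
    (Mpos : binoid_positive M) (Mint : binoid_integral M)
    (Mfg : finitely_generated M) :
  (separated M <->
     exists k : nat, (1 <= k)%N /\ positively_graded M {ffun 'I_k -> nat}) /\
  ((exists k : nat, (1 <= k)%N /\ positively_graded M {ffun 'I_k -> nat}) <->
     positively_graded M nat).
Proof.
have [nz _] := Mint.
have ex_nat : (exists k : nat, (1 <= k)%N /\
    positively_graded M {ffun 'I_k -> nat}) <-> positively_graded M nat.
  split=> [[k [_]]|gr]; first exact: positively_graded_ffun_nat.
  by exists 1%N; split=> //; apply: positively_graded_nat_ffun1.
split=> //; rewrite ex_nat; split.
  exact: separated_positively_graded_nat.
exact: positively_graded_nat_separated.
Qed.
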